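(* Let $\Lambda$ be the function defined below. If $0<\beta<\frac{\pi}{2}$, then $$D_{\beta,0}=\min_{\{\theta:\frac{1}{11}\beta\le\theta\le 2\beta\}}\Lambda(\beta,\theta),$$ while if $\frac{\pi}{2}\le\beta<\infty$, then $$D_{\beta,0}=\min_{\{\theta:\frac{1}{7}\le\theta\le\pi\}}\Lambda(\beta,\theta).$$
   Context: Let $\mathcal{H}=\{(x,v)\in\mathbb{R}^2:v\ge 0\}$ and let $d_H$ be the Riemannian distance on $\mathcal{H}$ induced by the metric $ds^2=v^{-1}(dx^2+dv^2)$ on the open upper half-plane (extended to the boundary $v=0$ as the infimum of lengths of curves). For $\beta,\gamma\in\mathbb{R}$ let $L_{\beta,\gamma}=\{(x,v)\in\mathcal{H}:x=\beta+\gamma v,\ v\ge0\}$ and $$D_{\beta,\gamma}=\inf\Big\{\tfrac{1}{2}d_H((0,1),(x,v))^2:(x,v)\in L_{\beta,\gamma}\Big\}.$$ Define, for $\theta\ne0$ and $x$ with $2(\theta-\sin\theta)x+2(1-\cos\theta)-\theta^2\ge0$, $$\Lambda(x,\theta)=\frac{\theta^2}{(\theta-\sin\theta)^2}\Big[(\theta-\sin\theta)x+2(1-\cos\theta)-\theta\sin\theta-(1-\cos\theta)\sqrt{2(\theta-\sin\theta)x+2(1-\cos\theta)-\theta^2}\Big],$$ with the nonnegative square root. *)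

(* Defs.v *)
From HB Require Import structures.
From mathcomp Require Import all_boot all_order all_algebra.
From mathcomp Require Import all_classical all_reals all_analysis.
Set Implicit Arguments. Unset Strict Implicit. Unset Printing Implicit Defensive.
Import Order.TTheory GRing.Theory Num.Theory.
Import numFieldNormedType.Exports.
Local Open Scope classical_set_scope.
Local Open Scope ring_scope.

Section Defs.
Variable R : realType.

(* A C^1 parametrised curve t |-> (x t, v t); only its restriction to [0,1]
   matters.  (Any C^1 curve on [0,1] extends to a C^1 curve on R.) *)
Definition C1curve (x v : R -> R) : Prop :=
  (forall t, derivable x t 1) /\ (forall t, derivable v t 1) /\
  continuous ((derive1 x)) /\ continuous ((derive1 v)).

(* Speed for the metric ds^2 = v^{-1}(dx^2+dv^2): sqrt((x'^2+v'^2)/v),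
   with value +oo on the boundary v = 0 when the velocity is nonzero and 0
   when the velocity vanishes. *)
Definition speedH (x v : R -> R) (t : R) : \bar R :=
  if 0 < v t then (Num.sqrt (((derive1 x) t ^+ 2 + (derive1 v) t ^+ 2) / v t))%:E
  else if (derive1 x) t ^+ 2 + (derive1 v) t ^+ 2 == 0 then 0%E else +oo%E.

Definition lengthH (x v : R -> R) : \bar R :=
  (\int[@lebesgue_measure R]_(t in `[0%R, 1%R]) speedH x v t)%E.

Definition dH (p q : R * R) : \bar R :=
  ereal_inf [set L | exists x v : R -> R,
    [/\ C1curve x v, (forall t, 0 <= t <= 1 -> 0 <= v t),
        (x 0, v 0) = p, (x 1, v 1) = q & L = lengthH x v]].

Definition Lline (b g : R) : set (R * R) :=
  [set p | 0 <= p.2 /\ p.1 = b + g * p.2].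

Definition Dbg (b g : R) : \bar R :=
  ereal_inf [set ((2^-1)%:E * (dH (0%R, 1%R) p * dH (0%R, 1%R) p))%E | p in Lline b g].

Definition Ldom (x th : R) : Prop :=
  th != 0 /\ 0 <= 2 * (th - sin th) * x + 2 * (1 - cos th) - th ^+ 2.

Definition Lambda (x th : R) : R :=
  th ^+ 2 / (th - sin th) ^+ 2 *
  ((th - sin th) * x + 2 * (1 - cos th) - th * sin th
   - (1 - cos th) * Num.sqrt (2 * (th - sin th) * x + 2 * (1 - cos th) - th ^+ 2)).

Definition is_min_on (S : set R) (f : R -> R) (m : R) : Prop :=
  exists2 t, S t & m = f t /\ (forall s, S s -> f t <= f s).

End Defs.

(* Main.v *)
(* The geodesics are arcs of cycloids r (phi - sin phi), r (1 - cos phi), of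
   length sqrt (2 r) * |Delta phi|.  For [th] in its domain, [Lambda b th] is half
   the squared length of an arc of angle [th] from (0, 1) to the line x = b, so
   D_{b,0} <= Lambda b th.  When the arc meets the line at a right angle,
   th = 2 atan u with (1 + u^2) atan u + u = b, and the arc is shortest.  This is
   shown by a calibration: the candidate distance to the line [dline] has gradient
   (1, -u) / sqrt ((1 + u^2) v), of norm 1 / sqrt v, hence decreases along any
   curve no faster than length is accumulated. *)
Require Import Defs.
From HB Require Import structures.
From mathcomp Require Import all_boot all_order all_algebra.
From mathcomp Require Import all_classical all_reals all_analysis.
From mathcomp Require Import ring lra.
Import Order.TTheory GRing.Theory Num.Theory.
Import numFieldNormedType.Exports.
Local Open Scope classical_set_scope.
Local Open Scope ring_scope.
Set Implicit Arguments. Unset Strict Implicit. Unset Printing Implicit Defensive.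

Section DistanceToLine.
Variable R : realType.
Implicit Types (u s t th b : R).

(** * The function [hcyc]: monotonicity, bijectivity, differentiable inverse *)

Lemma is_derive_cont (f : R -> R) t d : is_derive t 1 f d -> {for t, continuous f}.
Proof.
by move=> fd; apply/differentiable_continuous/derivable1_diffP; case: fd.
Qed.

(* [hcyc u] is the quotient (horizontal distance to the vertical line) / v at a
   point of the cycloid that meets the line at a right angle, where [u] is the
   tangent of half the angle still to be rolled. *)
Definition hcyc (u : R) : R := (1 + u ^+ 2) * atan u + u.

Lemma is_derive_hcyc u : is_derive u 1 hcyc (2 * (u * atan u) + 2).
Proof.
apply: is_derive_eq.
rewrite -![_ *: _]/(_ * _).
have u1 : 1 + u ^+ 2 != 0 by rewrite gt_eqF// ltr_wpDr// sqr_ge0.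
by field.
Qed.

Lemma atan_ge0 u : 0 <= u -> 0 <= atan u.
Proof. by move=> u0; rewrite -atan0; exact: le_atan. Qed.

Lemma atan_gt0 u : 0 < u -> 0 < atan u.
Proof. by move=> u0; rewrite -atan0; exact: lt_atan. Qed.

(** Both factors have the sign of [u]. Hence the derivative of [hcyc] is at least 2, which makes
    [hcyc] strictly increasing and [hinv] differentiable everywhere. *)
Lemma mul_atan_ge0 u : 0 <= u * atan u.
Proof.
have [u0|u0] := leP 0 u; first by rewrite mulr_ge0// atan_ge0.
by rewrite -mulrNN -atanN mulr_ge0 ?atan_ge0// oppr_ge0 ltW.
Qed.

Lemma continuous_hcyc : continuous hcyc.
Proof. by move=> u; exact: is_derive_cont (is_derive_hcyc u). Qed.

Lemma hcyc_lt : {homo hcyc : u s / u < s}.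
Proof.
move=> a b ab.
have [|c _ /eqP] := MVT ab (fun c _ => is_derive_hcyc c).
  exact/continuous_subspaceT/continuous_hcyc.
rewrite -subr_gt0 => /eqP ->; rewrite mulr_gt0 ?subr_gt0//.
by have := mul_atan_ge0 c; lra.
Qed.

Lemma hcyc_inj : injective hcyc.
Proof.
by move=> a b ab; case: (ltgtP a b) => // /hcyc_lt; rewrite ab ltxx.
Qed.

Lemma hcycN u : hcyc (- u) = - hcyc u.
Proof. by rewrite /hcyc sqrrN atanN mulrN opprD. Qed.

Lemma le_hcyc u : 0 <= u -> u <= hcyc u.
Proof. by move=> u0; rewrite lerDr mulr_ge0 ?atan_ge0// addr_ge0 ?sqr_ge0. Qed.

(** Intermediate values on [[-|b|, |b|]]: by [le_hcyc] and oddness, [hcyc] takes values at least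
    [|b|] and at most [-|b|] at the ends. *)
Lemma hcyc_surj b : exists u, hcyc u = b.
Proof.
have b0 := normr_ge0 b.
have [|||u _ ub] := @IVT R hcyc (- `|b|) `|b| b; last by exists u.
- by rewrite ge0_cp.
- exact/continuous_subspaceT/continuous_hcyc.
- have := le_hcyc b0; rewrite hcycN => bh.
  rewrite ge_min le_max; apply/andP; split; apply/orP; [left|right].
    by rewrite lerNl (le_trans _ bh)// -normrN ler_norm.
by rewrite (le_trans _ bh)// ler_norm.
Qed.

Definition hinv (b : R) : R := sval (cid (hcyc_surj b)).

Lemma hinvK : cancel hinv hcyc.
Proof. by move=> b; rewrite /hinv; case: cid. Qed.

Lemma hcycK : cancel hcyc hinv.
Proof. by move=> u; apply: hcyc_inj; rewrite hinvK. Qed.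

Lemma hinv0 : hinv 0 = 0.
Proof. by rewrite -[RHS]hcycK /hcyc atan0 mulr0 addr0. Qed.

Lemma is_derive_hinv b :
  is_derive b 1 hinv (2 * (hinv b * atan (hinv b)) + 2)^-1.
Proof.
rewrite -{1}(hinvK b).
apply: (@is_derive_inverse R hcyc).
- by near=> u; exact: hcycK.
- by near=> u; exact: continuous_hcyc.
- exact: is_derive_hcyc.
by rewrite gt_eqF//; have := mul_atan_ge0 (hinv b); lra.
Unshelve. all: by end_near.
Qed.

(** * The candidate distance to a vertical line and its gradient *)

(* The Riemannian distance from a point at height [v] to a vertical line at
   signed horizontal distance [y]. *)
Definition dline (y v : R) : R :=
  let u := hinv (y / v) in 2 * atan u * Num.sqrt ((1 + u ^+ 2) * v).

Lemma dline0 v : dline 0 v = 0.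
Proof. by rewrite /dline mul0r hinv0 atan0 mulr0 mul0r. Qed.

Lemma is_derive_dline (y v : R -> R) t dy dv :
    0 < v t -> is_derive t 1 y dy -> is_derive t 1 v dv ->
  let u := hinv (y t / v t) in
  is_derive t 1 (fun t => dline (y t) (v t))
    ((dy - u * dv) / Num.sqrt ((1 + u ^+ 2) * v t)).
Proof.
move=> v0 yd vd u.
have vn0 : v t != 0 by rewrite gt_eqF.
have vid : is_derive t 1 (fun t => (v t)^-1) (- (v t) ^- 2 * dv).
  exact: is_deriveV.
have qd : is_derive t 1 (fun t => y t / v t)
    (y t * (- (v t) ^- 2 * dv) + (v t)^-1 * dy).
  exact: is_deriveM.
have hd := is_derive_hinv (y t / v t).
pose a := hinv \o (fun t => y t / v t).
have ud : is_derive t 1 a _ := @is_derive1_comp R hinv (fun t => y t / v t) t _ _ hd qd.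
rewrite -/u in ud.
have hu : (1 + u ^+ 2) * atan u + u = y t / v t by exact: hinvK.
set du := (X in is_derive _ _ _ X) in ud.
have h2 : 0 < 2 * (u * atan u) + 2 by have := mul_atan_ge0 u; lra.
(* This is [hcyc u * v = y] differentiated; it eliminates [dy], after which all terms in [du]
   cancel. *)
have duE : (2 * (u * atan u) + 2) * du * v t + ((1 + u ^+ 2) * atan u + u) * dv = dy.
  rewrite hu /du; field; rewrite vn0/=.
  by rewrite gt_eqF.
have u1 : 0 < 1 + u ^+ 2 by rewrite ltr_wpDr// sqr_ge0.
have s0 : 0 < (1 + u ^+ 2) * v t by rewrite mulr_gt0.
pose W := fun t => (1 + a t ^+ 2) * v t.
have s0' : 0 < W t by [].
have Wd : is_derive t 1 W ((1 + u ^+ 2) * dv + 2 * u * du * v t).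
  rewrite /W; apply: is_derive_eq.
  rewrite -![_ *: _]/(_ * _) -[a t]/u. by ring.
have Sd := @is_derive1_comp R Num.sqrt W t _ _ (is_derive1_sqrt s0') Wd.
have Ad := @is_derive1_comp R atan a t _ _ (is_derive1_atan (a t)) ud.
have c2 := is_derive_cst (2 : R) t (1 : R).
apply: (is_derive_eq
  (@is_deriveM R _ _ _ _ _ _ _ (@is_deriveM R _ _ _ _ _ _ _ c2 Ad) Sd)).
rewrite -![_ *: _]/(_ * _) -[a t]/u -[W t]/((1 + u ^+ 2) * v t) /=.
set S := Num.sqrt _.
have S0 : S != 0 by rewrite gt_eqF// sqrtr_gt0.
have SE : S ^+ 2 = (1 + u ^+ 2) * v t by rewrite sqr_sqrtr// ltW.
have SdE : S * (2 * ((1 + u ^+ 2)^-1 * du)) = 2 * du * v t / S.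
  apply: (mulIf S0); rewrite mulfVK// [S * _ * S]mulrAC -expr2 SE.
  by field; rewrite gt_eqF.
rewrite mulr0 addr0 SdE -duE /=.
rewrite -[atan (a t)]/(atan u) -[_ t]/(2 * atan u); field.
exact: S0.
Qed.

(** * Lower bound on the length of curves reaching the line *)

Import HBNNSimple.

(** The integral of a nonnegative function is a supremum over simple functions below it, so it is
    monotone. This applies directly to [speedH], with its values 0 and +oo at the boundary. *)
Lemma le_integral_nonmeasurable d (T : measurableType d)
    (mu : {measure set T -> \bar R}) (D : set T) (f g : T -> \bar R) :
    (forall x, D x -> 0 <= f x)%E -> (forall x, D x -> f x <= g x)%E ->
  (\int[mu]_(x in D) f x <= \int[mu]_(x in D) g x)%E.
Proof.
move=> f0 fg.
rewrite !ge0_integralE//; last by move=> x Dx; rewrite (le_trans (f0 x Dx))// fg.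
apply: ereal_sup_le => _ [h hf <-]; exists h => //.
by move=> x; apply: le_trans (hf x) _; apply: lee_restrict.
Qed.

(** Cauchy-Schwarz for [(1, u)] and [(a, b)]; it compares the rate of change of [dline] with the
    speed. *)
Lemma cauchy2 (a b u : R) :
  `|a + u * b| <= Num.sqrt (1 + u ^+ 2) * Num.sqrt (a ^+ 2 + b ^+ 2).
Proof.
rewrite -sqrtrM ?addr_ge0 ?sqr_ge0// -sqrtr_sqr ler_sqrt.
  by rewrite -subr_ge0 (_ : _ - _ = (b - u * a) ^+ 2) ?sqr_ge0//; ring.
by rewrite mulr_ge0// ?addr_ge0 ?sqr_ge0.
Qed.

(* Raising the curve by [e] keeps it off the boundary, where the metric
   degenerates, without increasing its length. *)
Lemma dline_raised_le_length (x v : R -> R) (b e : R) :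
    C1curve x v -> (forall t, 0 <= t <= 1 -> 0 <= v t) -> 0 < e ->
    x 0 = 0 -> v 0 = 1 -> x 1 = b ->
  ((dline b (1 + e))%:E <= lengthH x v)%E.
Proof.
move=> [xd [vd [xc vc]]] v0 e0 x0 v01 x1.
(* [F] is the candidate distance from the raised point to the line, and [f] is its derivative along
   the curve. *)
pose u t := hinv ((b - x t) / (v t + e)).
pose f t := (- derive1 x t - u t * derive1 v t) / Num.sqrt ((1 + u t ^+ 2) * (v t + e)).
pose F t := dline (b - x t) (v t + e).
have ve t : 0 <= t <= 1 -> 0 < v t + e by move=> /v0; lra.
have xD t : is_derive t 1 x (derive1 x t).
  by rewrite derive1E; exact: derivableP.
have vD t : is_derive t 1 v (derive1 v t).
  by rewrite derive1E; exact: derivableP.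
have bxD t : is_derive t 1 (fun r => b - x r) (- derive1 x t).
  by apply: is_derive_eq; rewrite add0r mul1r.
have veD t : is_derive t 1 (fun r => v r + e) (derive1 v t).
  by apply: is_derive_eq; rewrite addr0.
have FD t : 0 <= t <= 1 -> is_derive t 1 F (f t).
  by move=> t01; apply: is_derive_dline => //; exact: ve.
have fcont t : 0 <= t <= 1 -> {for t, continuous f}.
  move=> t01.
  have uc : {for t, continuous u}.
    apply: (@continuous_comp _ _ _ (fun t => (b - x t) / (v t + e)) hinv).
      apply: cvgM; first exact: is_derive_cont (bxD t).
      apply: cvgV; first by rewrite gt_eqF// ve.
      exact: is_derive_cont (veD t).
    exact: is_derive_cont (is_derive_hinv _).
  apply: cvgM.
    apply: cvgB; first by apply: cvgN; exact: xc.
    by apply: cvgM => //; exact: vc.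
  apply: cvgV.
    by rewrite gt_eqF// sqrtr_gt0 mulr_gt0 ?ve// ltr_wpDr ?sqr_ge0.
  apply: (@continuous_comp _ _ _ (fun t => (1 + u t ^+ 2) * (v t + e)) Num.sqrt).
    apply: cvgM; last exact: is_derive_cont (veD t).
    apply: cvgD; first exact: cvg_cst.
    by under eq_fun do rewrite expr2; rewrite expr2; apply: cvgM.
  exact: sqrt_continuous.
have fcw : {within `[0, 1], continuous f}.
  by apply: continuous_in_subspaceT => t; rewrite inE/= in_itv/= => /fcont.
have intf : (\int[lebesgue_measure]_(t in `[0%R, 1%R]) (f t)%:E =
    (F 1)%:E - (F 0)%:E)%E.
  apply: continuous_FTC2 => //.
    split.
    - by move=> t /itvP t01; have := FD t; rewrite !t01 => /(_ isT) [].
    - apply: cvg_at_right_filter; apply: is_derive_cont (FD 0 _).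
      by rewrite lexx ler01.
    - apply: cvg_at_left_filter; apply: is_derive_cont (FD 1 _).
      by rewrite lexx ler01.
  by move=> t /itvP t01; rewrite derive1E; have := FD t; rewrite !t01 => /(_ isT) [].
have F1 : F 1 = 0.
  by rewrite /F x1 subrr dline0.
have F0 : F 0 = dline b (1 + e) by rewrite /F x0 v01 subr0.
(* [F] falls from [dline b (1 + e)] to 0, so the integral of [|f|] is at least [dline b (1 + e)]; it
   remains to bound [|f|] by the speed pointwise. *)
apply: (@le_trans _ _ (\int[lebesgue_measure]_(t in `[0%R, 1%R]) `|(f t)%:E|)%E).
  have := @le_abse_integral _ _ R lebesgue_measure `[0%R, 1%R]
    (fun t => (f t)%:E) (measurable_itv _).
  rewrite intf F1 F0 sub0e abseN => le_int.
  apply: le_trans (le_int _); first by rewrite /= lee_fin ler_norm.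
  apply/measurable_realfun.measurable_EFinP.
  exact: measurable_realfun.subspace_continuous_measurable_fun.
apply: le_integral_nonmeasurable => //= t; rewrite /= in_itv/= => t01.
(* On the boundary the speed is +oo unless the velocity vanishes, and then [f t] is 0. *)
rewrite /speedH; case: ifPn => vt; last first.
  case: ifPn => [|_]; last by rewrite leey.
  rewrite paddr_eq0 ?sqr_ge0// !sqrf_eq0 => /andP[/eqP xe /eqP ve0].
  by rewrite /f xe ve0 mulr0 !oppr0 addr0 mul0r normr0.
rewrite lee_fin /f.
have vet := ve _ t01.
have u1 : 0 < 1 + u t ^+ 2 by rewrite ltr_wpDr ?sqr_ge0.
rewrite sqrtrM ?(ltW u1)// normrM normfV [X in _ / X]ger0_norm ?mulr_ge0 ?sqrtr_ge0//.
rewrite ler_pdivrMr ?mulr_gt0 ?sqrtr_gt0// -opprD normrN.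
(* Cauchy-Schwarz leaves the speed with denominator [v t + e], which is at least [v t]. *)
apply: le_trans (cauchy2 _ _ _) _.
rewrite [leRHS]mulrCA ler_pM2l ?sqrtr_gt0//.
rewrite -sqrtrM; last by rewrite divr_ge0 ?addr_ge0 ?sqr_ge0 ?ltW.
rewrite ler_sqrt; last first.
  by rewrite mulr_ge0 ?divr_ge0 ?addr_ge0 ?sqr_ge0 ?ltW.
rewrite mulrAC ler_pdivlMr// ler_wpM2l ?addr_ge0 ?sqr_ge0//.
by rewrite lerDl ltW.
Qed.

Lemma hcyc_gt0 u : 0 < u -> 0 < hcyc u.
Proof. by move=> u0; exact: lt_le_trans (le_hcyc (ltW u0)). Qed.

(** Limit of the raised bound as the raise tends to 0. It is parametrised by [s < u]: the raise to
    height [hcyc u / hcyc s] makes the slope parameter exactly [s], so the bound is at least [Q s],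
    and [s] tends to [u] from the left. *)
Lemma length_to_line_ge (x v : R -> R) u :
    0 < u -> C1curve x v -> (forall t, 0 <= t <= 1 -> 0 <= v t) ->
    x 0 = 0 -> v 0 = 1 -> x 1 = hcyc u ->
  ((2 * atan u * Num.sqrt (1 + u ^+ 2))%:E <= lengthH x v)%E.
Proof.
move=> u0 C v0 x0 v01 x1.
pose Q s := 2 * atan s * Num.sqrt (1 + s ^+ 2).
have Qle s : 0 < s < u -> ((Q s)%:E <= lengthH x v)%E.
  move=> /andP[s0 su].
  have hs := hcyc_gt0 s0; have hu := hcyc_gt0 u0.
  have hsu := hcyc_lt su.
  have q1 : 1 < hcyc u / hcyc s by rewrite ltr_pdivlMr// mul1r.
  have e0 : 0 < hcyc u / hcyc s - 1 by rewrite subr_gt0.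
  apply: le_trans (dline_raised_le_length C v0 e0 x0 v01 x1).
  have uE : hcyc u / (hcyc u / hcyc s) = hcyc s.
    by rewrite invf_div mulrC mulfVK// gt_eqF.
  rewrite lee_fin /dline addrC subrK uE hcycK /Q ler_wpM2l ?mulr_ge0 ?atan_ge0 ?ltW//.
  rewrite ltr_sqrt; last by rewrite mulr_gt0 ?divr_gt0// ltr_wpDr ?sqr_ge0.
  by rewrite ltr_pMr// ltr_wpDr ?sqr_ge0.
have Qc : {for u, continuous Q}.
  apply: cvgM.
    by apply: cvgM; [exact: cvg_cst|exact: continuous_atan].
  apply: (@continuous_comp _ _ _ (fun s => 1 + s ^+ 2) Num.sqrt).
    by apply: cvgD; [exact: cvg_cst|exact: exprn_continuous].
  exact: sqrt_continuous.
case: (lengthH x v) Qle => [l| |] Qle; last 2 first.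
- by rewrite leey.
- have u2 : 0 < u / 2 < u by apply/andP; split; lra.
  by have := Qle _ u2; rewrite leeNy_eq.
rewrite lee_fin; apply: (@cvgr_to_le _ _ _ _ Q) (cvg_at_left_filter Qc) _.
near=> s; rewrite -lee_fin; apply: Qle; apply/andP; split; near: s.
  exact: nbhs_left_gt.
exact: nbhs_left_lt.
Unshelve. all: by end_near.
Qed.

(** * Upper bound by explicit cycloid arcs *)

Lemma cos_2atan s : cos (2 * atan s) = (1 - s ^+ 2) / (1 + s ^+ 2).
Proof.
have s1 : 0 < 1 + s ^+ 2 by rewrite ltr_wpDr ?sqr_ge0.
rewrite mulr_natl cos_mulr2n cos_atan exprVn sqr_sqrtr ?ltW//.
by rewrite -mulr_natl; field; rewrite gt_eqF.
Qed.

Lemma sin_2atan s : sin (2 * atan s) = 2 * s / (1 + s ^+ 2).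
Proof.
have s1 : 0 < 1 + s ^+ 2 by rewrite ltr_wpDr ?sqr_ge0.
have c0 : cos (atan s) != 0.
  by rewrite cos_atan invr_neq0// gt_eqF// sqrtr_gt0.
have -> : sin (2 * atan s) = 2 * (tan (atan s) * cos (atan s) ^+ 2).
  by rewrite mulr_natl sin_mulr2n -mulr_natl /tan; field.
by rewrite atanK cos_atan exprVn sqr_sqrtr ?ltW// mulrA.
Qed.

Lemma speedH_ge0 (x v : R -> R) t : (0 <= speedH x v t)%E.
Proof.
rewrite /speedH; case: ifPn => _; first by rewrite lee_fin sqrtr_ge0.
by case: ifPn => // _; rewrite leey.
Qed.

(** The arc runs on a cycloid of radius [r = (1 + s^2) / 2], starting at height 1 with slope [s],
    and has constant speed [th * sqrt (2 r)]. At a cusp on the boundary its velocity vanishes, so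
    [speedH] is 0 there. *)
Lemma dH_cycloid s th : 0 <= th ->
  (dH (0%R, 1%R) ((1 + s ^+ 2) / 2 * (th + sin (2 * atan s) - sin (2 * atan s - th)),
                  (1 + s ^+ 2) / 2 * (1 + cos (2 * atan s - th)))%R
   <= (th * Num.sqrt (1 + s ^+ 2))%:E)%E.
Proof.
move=> th0.
have s1 : 0 < 1 + s ^+ 2 by rewrite ltr_wpDr ?sqr_ge0.
pose r := (1 + s ^+ 2) / 2.
have r0 : 0 < r by rewrite divr_gt0.
pose W t := 2 * atan s - th * t.
pose x t := r * (th * t + sin (2 * atan s) - sin (W t)).
pose v t := r * (1 + cos (W t)).
have WD t : is_derive t 1 W (- th).
  by apply: is_derive_eq; rewrite -![_ *: _]/(_ * _); ring.
have sD t : is_derive t 1 (fun t => sin (W t)) (cos (W t) * - th).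
  exact: (@is_derive1_comp R (@sin R) W).
have cD t : is_derive t 1 (fun t => cos (W t)) (- sin (W t) * - th).
  exact: (@is_derive1_comp R (@cos R) W).
have xD t : is_derive t 1 x (r * th * (1 + cos (W t))).
  by apply: is_derive_eq; rewrite -![_ *: _]/(_ * _); ring.
have vD t : is_derive t 1 v (r * th * sin (W t)).
  by apply: is_derive_eq; rewrite -![_ *: _]/(_ * _); ring.
have xE : derive1 x = fun t => r * th * (1 + cos (W t)).
  by apply/funext => t; rewrite derive1E; case: (xD t).
have vE : derive1 v = fun t => r * th * sin (W t).
  by apply/funext => t; rewrite derive1E; case: (vD t).
have v0 t : 0 <= v t.
  by apply: mulr_ge0; [exact: ltW|have := cos_geN1 (W t); lra].
have speed t : (derive1 x) t ^+ 2 + (derive1 v) t ^+ 2 =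
    (th ^+ 2 * (1 + s ^+ 2)) * v t.
  by rewrite xE vE !exprMn sin2cos2 /v /r; field.
apply: (@le_trans _ _ (lengthH x v)).
  apply: ereal_inf_lbound; exists x, v; split => //.
  - split; first by move=> t; case: (xD t).
    split; first by move=> t; case: (vD t).
    rewrite xE vE; split => t.
      apply: cvgM; first exact: cvg_cst.
      by apply: cvgD; [exact: cvg_cst|exact: is_derive_cont (cD t)].
    by apply: cvgM; [exact: cvg_cst|exact: is_derive_cont (sD t)].
  - rewrite /x /v /W !mulr0 subr0 add0r subrr mulr0 cos_2atan; congr (_, _).
    by rewrite /r; field; rewrite gt_eqF.
  - by rewrite /x /v /W !mulr1.
rewrite /lengthH.
have -> : (th * Num.sqrt (1 + s ^+ 2))%:E =
    (\int[@lebesgue_measure R]_(t in `[0%R, 1%R])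
      (th * Num.sqrt (1 + s ^+ 2))%:E)%E.
  by rewrite integral_cst//= lebesgue_measure_itv/= lte_fin ltr01 oppr0 adde0 mule1.
apply: le_integral_nonmeasurable => t _; first exact: speedH_ge0.
rewrite /speedH speed.
case: ifPn => vt.
  by rewrite lee_fin mulfK ?gt_eqF// sqrtrM ?sqr_ge0// sqrtr_sqr ger0_norm.
have -> : v t = 0 by apply/eqP; rewrite eq_le v0 leNgt vt.
by rewrite mulr0 eqxx lee_fin mulr_ge0 ?sqrtr_ge0.
Qed.

(* The quadratic equation says that the cycloid arc of total angle [th] and
   initial slope parameter [s] ends on the line [x = b]. *)
Lemma Dbg_le_cycloid b s th : 0 <= th ->
    (th - sin th) * s ^+ 2 + 2 * (1 - cos th) * s + th + sin th = 2 * b ->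
  (Dbg b 0 <= ((1 + s ^+ 2) / 2 * th ^+ 2)%:E)%E.
Proof.
move=> th0 quad.
have s1 : 0 < 1 + s ^+ 2 by rewrite ltr_wpDr ?sqr_ge0.
have := dH_cycloid s th0; set w := 2 * atan s - th; set p := (X in dH _ X).
move=> dHp.
have pL : Lline b 0 p.
  split => /=.
    by apply: mulr_ge0; [rewrite divr_ge0 ?ltW|have := cos_geN1 w; lra].
  rewrite mul0r addr0 /w sinB sin_2atan cos_2atan.
  have -> : b = 2 * b / 2 by field.
  by rewrite -quad; field; rewrite gt_eqF.
have d0 : (0 <= dH (0%R, 1%R) p)%E.
  apply: le_ereal_inf_tmp => _ [x [v [_ _ _ _ ->]]].
  by apply: integral_ge0 => t _; exact: speedH_ge0.
apply: le_trans; first by apply: ereal_inf_lbound; exists p; first exact: pL.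
set q := th * Num.sqrt (1 + s ^+ 2) in dHp.
apply: (@le_trans _ _ ((2^-1)%:E * (q%:E * q%:E))%E).
  by rewrite lee_wpmul2l ?lee_fin ?invr_ge0// lee_pmul.
rewrite -!EFinM lee_fin -expr2 /q exprMn sqr_sqrtr; last exact: ltW.
by rewrite [leLHS](_ : _ = (1 + s ^+ 2) / 2 * th ^+ 2)//; field.
Qed.

(** * Identification of [Lambda] with half squared arc lengths *)

Lemma sin_lt th : 0 < th <= pi -> sin th < th.
Proof.
move=> /andP[th0 thpi].
have [|c /itvP c0 /eqP] := MVT th0 (fun c _ => is_derive_sin c).
  exact/continuous_subspaceT/continuous_sin.
rewrite sin0 !subr0 => /eqP ->; rewrite gtr_pMl//.
have sc : 0 < sin c by rewrite sin_gt0_pi// c0/= (lt_le_trans _ thpi)// c0.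
have := cos2Dsin2 c; have := exprn_gt0 2 sc => s2 cs.
(* [cos c = 1] would force [sin c = 0]. *)
by have := cos_le1 c; rewrite le_eqVlt => /predU1P[c1|//]; move: cs; rewrite c1; lra.
Qed.

(** The radicand in [Lambda] is a quarter of the discriminant of the quadratic in [s]; the sign
    condition says that [s] is the larger root, matching the nonnegative square root. *)
Lemma LambdaE b th s : 0 < th <= pi ->
    (th - sin th) * s ^+ 2 + 2 * (1 - cos th) * s + th + sin th = 2 * b ->
    0 <= (th - sin th) * s + (1 - cos th) ->
  Ldom b th /\ Lambda b th = (1 + s ^+ 2) / 2 * th ^+ 2.
Proof.
move=> th0 quad root_ge0.
have A0 : th - sin th != 0 by rewrite gt_eqF// subr_gt0 sin_lt.
have bE : b = ((th - sin th) * s ^+ 2 + 2 * (1 - cos th) * s + th + sin th) / 2.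
  by rewrite quad; field.
have disc : 2 * (th - sin th) * b + 2 * (1 - cos th) - th ^+ 2 =
    ((th - sin th) * s + (1 - cos th)) ^+ 2.
  have s2 : sin th ^+ 2 = 1 - cos th ^+ 2 by exact: sin2cos2.
  (* Adding [sin^2 - sin^2] with one copy rewritten as [1 - cos^2] supplies the Pythagorean identity
     to [field]. *)
  rewrite bE -[LHS]addr0 -[0](subrr (sin th ^+ 2)) {2}s2; by field.
split.
  split; first by rewrite gt_eqF//; case/andP: th0.
  by rewrite disc sqr_ge0.
rewrite /Lambda disc sqrtr_sqr ger0_norm//.
have -> : (th - sin th) * b + 2 * (1 - cos th) - th * sin th -
    (1 - cos th) * ((th - sin th) * s + (1 - cos th)) =
    (th - sin th) ^+ 2 * ((1 + s ^+ 2) / 2).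
  have s2 : sin th ^+ 2 = 1 - cos th ^+ 2 by exact: sin2cos2.
  rewrite bE -[LHS]addr0 -[0](subrr (sin th ^+ 2)) {2}s2; by field.
by field.
Qed.

Lemma Dbg_le_Lambda b th : 0 < th <= pi -> Ldom b th ->
  (Dbg b 0 <= (Lambda b th)%:E)%E.
Proof.
move=> th0 [_ disc0].
have A0 : 0 < th - sin th by rewrite subr_gt0 sin_lt.
set disc := (X in 0 <= X) in disc0.
(* The larger root of the quadratic, so that the arc of angle [th] ends on the line. *)
pose s := (Num.sqrt disc - (1 - cos th)) / (th - sin th).
have sE : (th - sin th) * s + (1 - cos th) = Num.sqrt disc.
  by rewrite /s mulrC mulfVK ?gt_eqF// subrK.
have quad : (th - sin th) * s ^+ 2 + 2 * (1 - cos th) * s + th + sin th = 2 * b.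
  apply: (mulfI (lt0r_neq0 A0)).
  have -> : (th - sin th) *
      ((th - sin th) * s ^+ 2 + 2 * (1 - cos th) * s + th + sin th) =
     ((th - sin th) * s + (1 - cos th)) ^+ 2 - (1 - cos th) ^+ 2
      + th ^+ 2 - sin th ^+ 2 by ring.
  by rewrite sE sqr_sqrtr// sin2cos2 /disc; ring.
have [|_ ->] := LambdaE th0 quad; first by rewrite sE sqrtr_ge0.
by apply: Dbg_le_cycloid => //; case/andP: th0 => /ltW.
Qed.

(** * The optimal arc and the minimum *)

Lemma atan_pi u : 0 < u -> 0 < 2 * atan u <= pi.
Proof.
move=> u0; rewrite mulr_gt0 ?atan_gt0//=.
by have := atan_ltpi2 u; lra.
Qed.

(** With [s = u] and angle [2 * atan u] the arc ends at the top of the cycloid, where the tangent is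
    horizontal: it meets the vertical line at a right angle. *)
Lemma quad_atan u : let th := 2 * atan u in
  (th - sin th) * u ^+ 2 + 2 * (1 - cos th) * u + th + sin th = 2 * hcyc u.
Proof.
have u1 : 0 < 1 + u ^+ 2 by rewrite ltr_wpDr ?sqr_ge0.
by rewrite /= sin_2atan cos_2atan /hcyc; field; rewrite gt_eqF.
Qed.

Lemma Dbg_ge u : 0 < u ->
  (((1 + u ^+ 2) / 2 * (2 * atan u) ^+ 2)%:E <= Dbg (hcyc u) 0)%E.
Proof.
move=> u0; have u1 : 0 < 1 + u ^+ 2 by rewrite ltr_wpDr ?sqr_ge0.
apply: le_ereal_inf_tmp => _ [[p1 p2] /= [_ p1E] <-].
rewrite mul0r addr0 /= in p1E.
set q := 2 * atan u * Num.sqrt (1 + u ^+ 2).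
have q0 : 0 <= q by rewrite !mulr_ge0 ?atan_ge0 ?sqrtr_ge0 ?ltW.
have dq : (q%:E <= dH (0%R, 1%R) (p1, p2))%E.
  apply: le_ereal_inf_tmp => _ [x [v [C v0 [x0 v01] [x1 _] ->]]].
  by apply: length_to_line_ge => //; rewrite x1.
apply: (@le_trans _ _ ((2^-1)%:E * (q%:E * q%:E))%E); last first.
  by rewrite lee_wpmul2l ?lee_fin ?invr_ge0// lee_pmul.
rewrite -!EFinM lee_fin -expr2 /q [(_ * Num.sqrt _) ^+ 2]exprMn sqr_sqrtr; last exact: ltW.
by rewrite [leRHS](_ : _ = (1 + u ^+ 2) / 2 * (2 * atan u) ^+ 2)//; field.
Qed.

(** Every admissible angle gives an upper bound for D, and [2 * atan u] attains the lower bound; so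
    it minimises over any interval inside []0, pi]] that contains it. *)
Lemma Dbg_eq_min u lo hi : 0 < u -> 0 < lo -> hi <= pi ->
    lo <= 2 * atan u <= hi ->
  exists2 m : R,
    is_min_on [set th | lo <= th <= hi /\ Ldom (hcyc u) th] (Lambda (hcyc u)) m
    & Dbg (hcyc u) 0 = m%:E.
Proof.
move=> u0 lo0 hipi uI.
have thpi := atan_pi u0.
have [|dom LE] := LambdaE thpi (quad_atan u).
  apply: addr_ge0; last by rewrite subr_ge0 cos_le1.
  by apply: mulr_ge0; apply: ltW => //; rewrite subr_gt0 sin_lt.
have Dge := Dbg_ge u0; rewrite -LE in Dge.
exists (Lambda (hcyc u) (2 * atan u)); last first.
  by apply/eqP; rewrite eq_le Dge Dbg_le_Lambda.
exists (2 * atan u); first by split.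
split=> // th [/andP[lth thh] domth].
rewrite -lee_fin; apply: (le_trans Dge); apply: Dbg_le_Lambda => //.
by rewrite (lt_le_trans lo0)//= (le_trans thh).
Qed.

(** * Numerical location of the optimal angle *)

(** For these [u], [u <= 2 u / (1 + u^2) = sin (2 atan u) < 2 atan u]. *)
Lemma le_atan2 u : 0 < u <= 1 -> u <= 2 * atan u.
Proof.
move=> /andP[u0 u1].
have := sin_lt (atan_pi u0); rewrite sin_2atan.
have u2 : 1 + u ^+ 2 <= 2.
  by rewrite [leRHS](_ : 2 = 1 + 1)// lerD2l expr_le1// ltW.
have u2' : 0 < 1 + u ^+ 2 by rewrite ltr_wpDr ?sqr_ge0.
rewrite ltr_pdivrMr// => h; rewrite -(ler_pM2l (ltr0n R 2))//.
apply: (le_trans (ltW h)); rewrite [leRHS]mulrC ler_wpM2l//.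
by rewrite mulr_ge0 ?atan_ge0// ltW.
Qed.

Lemma hcyc_le_atan u : 0 < u <= 1 -> hcyc u <= 4 * atan u.
Proof.
move=> u01; have := le_atan2 u01; case/andP: u01 => u0 u1.
have : u ^+ 2 * atan u <= atan u.
  by rewrite ger_pMl ?atan_gt0// expr_le1// ltW.
by rewrite /hcyc mulrDl mul1r; lra.
Qed.

End DistanceToLine.

Theorem theorem2p1 (R : realType) (beta : R) :
  (0 < beta < pi / 2 ->
     exists2 m : R,
       is_min_on [set th | beta / 11 <= th <= 2 * beta /\ Ldom beta th]
                 (Lambda beta) m
       & Dbg beta 0 = m%:E) /\
  (pi / 2 <= beta ->
     exists2 m : R,
       is_min_on [set th | 1 / 7 <= th <= pi /\ Ldom beta th]
                 (Lambda beta) m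
       & Dbg beta 0 = m%:E).
Proof.
have [u <-] := hcyc_surj beta.
have pi2 := pi_ge2 R.
have u_gt0 : 0 < hcyc u -> 0 < u.
  move=> hu; rewrite ltNge; apply/negP; rewrite -oppr_ge0 => u0.
  by have := le_hcyc u0; rewrite hcycN; lra.
split=> [/andP[h0 hpi]|hpi].
- have u0 := u_gt0 h0.
  (* [hcyc 1 = pi / 2 + 1] exceeds [pi / 2]. *)
  have u1 : u <= 1.
    rewrite leNgt; apply/negP => /hcyc_lt.
    by rewrite {1}/hcyc atan1 expr1n; lra.
  apply: Dbg_eq_min => //; [by lra|by lra|].
  (* From [atan u <= beta <= 4 * atan u], the optimal angle lies between [beta / 2] and
     [2 * beta]. *)
  have u01 : 0 < u <= 1 by rewrite u0.
  have := hcyc_le_atan u01.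
  have := atan_gt0 u0.
  have : atan u <= hcyc u.
    rewrite /hcyc mulrDl mul1r -addrA lerDl.
    apply: addr_ge0; last exact: ltW.
    by rewrite mulr_ge0 ?sqr_ge0// atan_ge0// ltW.
  by move=> *; apply/andP; split; lra.
- have u0 : 0 < u by apply: u_gt0; lra.
  apply: Dbg_eq_min => //.
  have /andP[_ ->] := atan_pi u0; rewrite andbT.
  (* If [u <= 1], the angle is at least [beta / 2 >= pi / 4]; otherwise it exceeds [pi / 2]. Both
     exceed [1 / 7] since [pi >= 2]. *)
  have [u1|u1] := leP u 1.
    have u01 : 0 < u <= 1 by rewrite u0.
    by have := hcyc_le_atan u01; lra.
  by have := lt_atan u1; rewrite atan1; lra.
Qed.
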